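(* Let $h\colon Z\to X$ be a holomorphic submersion of complex manifolds, let $z\in Z$, and let $s_j\colon E_j\to Z$ ($j=1,2,\dots,k$) be $h$-sprays. The collection $(s_1,\dots,s_k)$ is dominating at $z$ if and only if the composed $h$-spray $s_1\#\cdots\#s_k\colon E_1\#\cdots\#E_k\to Z$ is dominating at $z$.
   Context: For $z\in Z$ let $VT_zZ=\ker dh_z$. For a holomorphic vector bundle $p\colon E\to Z$ let $E_z=p^{-1}(z)$ and let $0_z\in E_z$ be the zero element; $T_{0_z}E=T_zZ\oplus E_z$. An $h$-spray is a triple $(E,p,s)$ where $p\colon E\to Z$ is a holomorphic vector bundle and $s\colon E\to Z$ is a holomorphic map such that $s(0_z)=z$ and $s(E_z)\subset h^{-1}(h(z))$ for every $z\in Z$. A collection of $h$-sprays $(E_j,p_j,s_j)$, $j=1,\dots,k$, is dominating at $z$ if $(ds_1)_{0_z}(E_{1,z})+\cdots+(ds_k)_{0_z}(E_{k,z})=VT_zZ$. The composed spray $(E^*,p^*,s^* )=(E_1\#\cdots\#E_k,\ p_1\#\cdots\#p_k,\ s_1\#\cdots\#s_k)$ is defined by $$E^*=\{(e_1,\dots,e_k)\in E_1\times\cdots\times E_k:\ s_j(e_j)=p_{j+1}(e_{j+1}),\ j=1,\dots,k-1\},$$ $$p^*(e_1,\dots,e_k)=p_1(e_1),\qquad s^*(e_1,\dots,e_k)=s_k(e_k).$$ Its zero section is $z\mapsto 0^*_z=(0_z,\dots,0_z)$. The composed spray is dominating at $z$ if the derivative at $0^*_z$ of the restriction of $s^*$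 to the fiber $E^*_z=(p^* )^{-1}(z)$ maps $T_{0^*_z}E^*_z$ surjectively onto $VT_zZ$. *)

(* Defs.v *)
From HB Require Import structures.
From mathcomp Require Import all_boot all_order all_algebra.
From mathcomp Require Import all_classical all_reals all_analysis.
From mathcomp.real_closed Require Import complex.

Set Implicit Arguments.
Unset Strict Implicit.
Unset Printing Implicit Defensive.

Import Order.TTheory GRing.Theory Num.Theory.
Import numFieldNormedType.Exports.

Local Open Scope classical_set_scope.
Local Open Scope ring_scope.

(* The [numFieldType] target is what gives R[i] its norm and topology, so that
   [differentiable] below is complex (Fréchet) differentiability. *)
Definition CC (R : realType) : numFieldType := R[i].

Record chart (R : realType) (T : topologicalType) (n : nat) := Chart {
  cdom : set T;
  cmap : T -> 'rV[CC R]_n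
}.

(* A preferred chart around each point; the atlas is the set of these charts.
   This is bare data: [is_manifold] states the manifold axioms. *)
Record charted (R : realType) (n : nat) := Charted {
  carrier :> topologicalType;
  chart_at : carrier -> chart R carrier n
}.

Section Manifold.
Context {R : realType}.
Local Notation C := (CC R).

(* Local coordinates around p, and their inverse (a junk value off the image
   of the coordinate domain). *)
Definition chart_map {n} (M : charted R n) (p : M) : M -> 'rV[C]_n :=
  cmap (chart_at p).

Definition chart_inv {n} (M : charted R n) (p : M) : 'rV[C]_n -> M :=
  'pinv_(fun=> p) (cdom (chart_at p)) (chart_map p).

Definition is_chart_at {n} (M : charted R n) (p : M) : Prop :=
  let D := cdom (chart_at p) in
  [/\ [/\ open D, D p & open (chart_map p @` D)],
      {in D &, injective (chart_map p)},
      (forall x, D x -> {for x, continuous (chart_map p)}) &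
      (forall y, (chart_map p @` D) y -> {for y, continuous (chart_inv p)})].

Definition compatible_charts {n} (M : charted R n) (p q : M) : Prop :=
  forall x : M, cdom (chart_at p) x -> cdom (chart_at q) x ->
    differentiable (chart_map q \o chart_inv p) (chart_map p x).

Definition is_manifold {n} (M : charted R n) : Prop :=
  [/\ hausdorff_space M, second_countable (T := M),
      (forall p : M, is_chart_at p) &
      (forall p q : M, compatible_charts p q)].

Definition in_coords {m n} (M : charted R m) (N : charted R n)
    (f : M -> N) (p : M) : 'rV[C]_m -> 'rV[C]_n :=
  chart_map (f p) \o f \o chart_inv p.

Definition holo_at {m n} (M : charted R m) (N : charted R n)
    (f : M -> N) (p : M) : Prop :=
  {for p, continuous f} /\ differentiable (in_coords f p) (chart_map p p).

Definition holo_on {m n} (M : charted R m) (N : charted R n)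
    (U : set M) (f : M -> N) : Prop :=
  forall p, U p -> holo_at f p.

(* T_pM is C^n, through the preferred chart at p; with that identification,
   [tangent f p] is the complex derivative T_pM -> T_(f p)N. *)
Definition tangent {m n} (M : charted R m) (N : charted R n)
    (f : M -> N) (p : M) : 'rV[C]_m -> 'rV[C]_n :=
  'd (in_coords f p) (chart_map p p).

Definition biholo {m n} (M : charted R m) (N : charted R n)
    (A : set M) (B : set N) (f : M -> N) (g : N -> M) : Prop :=
  [/\ holo_on A f, holo_on B g,
      (forall x, A x -> B (f x) /\ g (f x) = x) &
      (forall y, B y -> A (g y) /\ f (g y) = y)].

Definition affine_space (n : nat) : charted R n :=
  Charted (fun _ : 'rV[C]_n => Chart [set: 'rV[C]_n] id).

Definition prod_charted {m n} (M : charted R m) (N : charted R n) :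
    charted R (m + n) :=
  Charted (fun x : (M * N)%type =>
    Chart [set y : (M * N)%type | cdom (chart_at x.1) y.1 /\
                                  cdom (chart_at x.2) y.2]
          (fun y => row_mx (chart_map x.1 y.1) (chart_map x.2 y.2))).

End Manifold.

Record manifold (R : realType) (n : nat) := Manifold {
  manifold_charted :> charted R n;
  manifoldP : is_manifold manifold_charted
}.

Definition submersion (R : realType) (n m : nat) (Z : manifold R n)
    (X : manifold R m) (h : Z -> X) : Prop :=
  holo_on [set: Z] h /\ forall z : Z, [set: 'rV[CC R]_m] `<=` range (tangent h z).

Definition VT (R : realType) (n m : nat) (Z : manifold R n) (X : manifold R m)
    (h : Z -> X) (z : Z) : set 'rV[CC R]_n :=
  [set v | tangent h z v = 0].

(* [vadd] is only meaningful on pairs of points of the same fiber.  The vector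
   space axioms in the fibers follow from [triv_linear]. *)
Record vbundle (R : realType) (n : nat) (Z : manifold R n) (r : nat) := VBundle {
  tot : manifold R (n + r);
  bproj : tot -> Z;
  vzero : Z -> tot;
  vadd : tot -> tot -> tot;
  vscale : CC R -> tot -> tot;
  triv_dom : Z -> set Z;
  triv : Z -> tot -> 'rV[CC R]_r;
  bproj_holo : holo_on [set: tot] bproj;
  bproj_zero : forall z, bproj (vzero z) = z;
  bproj_add : forall e e', bproj e = bproj e' -> bproj (vadd e e') = bproj e;
  bproj_scale : forall a e, bproj (vscale a e) = bproj e;
  triv_open : forall z, open (triv_dom z);
  triv_mem : forall z, triv_dom z z;
  triv_biholo : forall z, exists g : prod_charted Z (affine_space r) -> tot,
    biholo (M := tot) (N := prod_charted Z (affine_space r))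
      (bproj @^-1` triv_dom z) (triv_dom z `*` setT)
      (fun e => (bproj e, triv z e)) g;
  triv_linear : forall z,
    [/\ (forall w, triv_dom z w -> triv z (vzero w) = 0),
        (forall e e', triv_dom z (bproj e) -> bproj e = bproj e' ->
           triv z (vadd e e') = triv z e + triv z e') &
        (forall a e, triv_dom z (bproj e) ->
           triv z (vscale a e) = a *: triv z e)]
}.

Arguments vzero {R n Z r} _ _.
Arguments triv_dom {R n Z r} _ _ _.
Arguments triv {R n Z r} _ _ _.

(* The inclusion of the summand E_z in T_(0_z)E = T_zZ (+) E_z: a vector e of
   E_z is sent to the velocity at t = 0 of the curve t |-> t e. *)
Definition vertical (R : realType) (n r : nat) (Z : manifold R n)
    (E : vbundle Z r) (z : Z) (e : tot E) : 'rV[CC R]_(n + r) :=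
  'D_1 (fun t : (CC R)^o => chart_map (vzero E z) (vscale t e)) 0.

Record spray (R : realType) (n m : nat) (Z : manifold R n) (X : manifold R m)
    (h : Z -> X) := Spray {
  srank : nat;
  sbundle :> vbundle Z srank;
  smap : tot sbundle -> Z;
  smap_holo : holo_on [set: tot sbundle] smap;
  smap_zero : forall z, smap (vzero sbundle z) = z;
  smap_fiber : forall e, h (smap e) = h (bproj e)
}.

Arguments smap {R n m Z X h} _ _.

Section Composed.
Context {R : realType} {n m : nat} {Z : manifold R n} {X : manifold R m}.
Context {h : Z -> X} {k : nat} (E : 'I_k.+1 -> spray h).

(* (ds)_(0_z)(E_z); the ambient space T_(s(0_z))Z is T_zZ as s(0_z) = z. *)
Definition spray_image (S : spray h) (z : Z) : set 'rV[CC R]_n :=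
  [set tangent (smap S) (vzero S z) (vertical z e)
     | e in [set e : tot S | bproj e = z]].

Definition dominating (z : Z) : Prop :=
  [set \sum_(j < k.+1) w j
     | w in [set w : 'I_k.+1 -> 'rV[CC R]_n
            | forall j, spray_image (E j) z (w j)]] = VT h z.

Definition tuples : topologicalType := prod_topology (fun j => tot (E j)).

(* The total space E^* of the composed spray; here indices run from 0 to k,
   i.e. there are k + 1 sprays. *)
Definition composed : set tuples :=
  [set e : tuples | forall i j : 'I_k.+1, j = i.+1 :> nat ->
     smap (E i) (e i) = bproj (e j)].

Definition composed_proj (e : tuples) : Z := bproj (e ord0).

Definition composed_map (e : tuples) : Z := smap (E ord_max) (e ord_max).

Definition composed_zero (z : Z) : tuples := fun j => vzero (E j) z.

Definition composed_fiber (z : Z) : set tuples :=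
  composed `&` composed_proj @^-1` [set z].

Lemma composed_zeroP (z : Z) : composed_zero z \in composed_fiber z.
Proof.
by rewrite inE; split=> [i j _|]; rewrite /composed_proj /= ?smap_zero bproj_zero.
Qed.

(* E^*_z with its complex structure: around e^0, the coordinates of
   (e_1,...,e_k) are the fiber coordinates of each e_j in the trivialization of
   E_j around the base point of e^0_j. *)
Definition fiber_charted (z : Z) : charted R (\sum_(j < k.+1) srank (E j)) :=
  Charted (fun e0 : set_type (composed_fiber z) =>
    Chart [set e : set_type (composed_fiber z) |
             forall j, triv_dom (E j) (bproj (val e0 j)) (bproj (val e j))]
          (fun e => \mxrow_j triv (E j) (bproj (val e0 j)) (val e j))).

End Composed.

Arguments composed_fiber {R n m Z X h k} E z _.
Arguments composed_zeroP {R n m Z X h k} E z.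
Arguments composed_map {R n m Z X h k} E e.

Lemma choice_dep (I : Type) (T : I -> Type) (P : forall i, T i -> Prop) :
  (forall i, exists x, P i x) -> exists f : forall i, T i, forall i, P i (f i).
Proof. by move=> PT; exists (fun i => projT1 (cid (PT i))) => i; case: cid. Qed.

Lemma initial_cvg (S : choiceType) (T : topologicalType) (f : S -> T)
    (F : set_system S) (s : S) : Filter F ->
  f @ F --> f s -> F --> (s : initial_topology f).
Proof.
move=> FF cvF A /= [B [[V oV <-] Vs sVA]].
have FV : F (f @^-1` V) by apply: cvF; apply: open_nbhs_nbhs.
exact: filterS sVA FV.
Qed.

Lemma prod_topology_cvg (I : Type) (T : I -> topologicalType)
    (F : set_system (prod_topology T)) (e : prod_topology T) : Filter F ->
  (forall i, (fun g : prod_topology T => g i) @ F --> e i) -> F --> e.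
Proof.
move=> FF cvF; apply/cvg_sup => i.
exact: (@initial_cvg _ _ (fun g : prod_topology T => g i)).
Qed.

Lemma second_countable_enum (T : topologicalType) : second_countable (T := T) ->
  exists u : nat -> set T, (forall n, open (u n)) /\
    forall x A, nbhs x A -> exists n, u n x /\ u n `<=` A.
Proof.
move=> [B /countable_injP[f finj] [Bo Bb]].
exists (fun n => xget set0 [set U | B U /\ f U = n]); split=> [n|x A nA].
  by case: xgetP => [U _ [/Bo]//|_]; exact: open0.
have [U [BU Ux] UA] := Bb x A nA; exists (f U).
case: xgetP => [V _ [BV /finj]|/(_ U)/not_andP[]//].
by rewrite !inE => -> //.
Qed.

Lemma enum_second_countable (T : topologicalType) (I : countType) (u : I -> set T) :
  (forall n, open (u n)) ->
  (forall x A, nbhs x A -> exists n, u n x /\ u n `<=` A) ->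
  second_countable (T := T).
Proof.
move=> uo ub; exists (range u); first exact: sub_countable (card_image_le _ _) (countableP _).
split=> [_ [n _ <-]//|x A /ub[n [unx unA]]].
by exists (u n).
Qed.

Lemma set_type_second_countable (T : topologicalType) (A : set T) :
  second_countable (T := T) -> second_countable (T := set_type A).
Proof.
move=> /second_countable_enum[u [uo ub]].
apply: (@enum_second_countable _ _ (fun n => (@set_val _ A) @^-1` u n)).
  by move=> n; exists (u n).
move=> x B [V [[W oW <-] Wx WB]].
have [n [unx unW]] := ub (set_val x) W (open_nbhs_nbhs (conj oW Wx)).
by exists n; split=> // y uny; apply: WB; exact: unW.
Qed.

Lemma prod_second_countable (I : finType) (T : I -> topologicalType) :
  (forall i, second_countable (T := T i)) ->
  second_countable (T := prod_topology T).
Proof.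
move=> Tsc.
have /choice_dep[u uP] : forall i, exists u : nat -> set (T i), (forall n, open (u n)) /\
    forall x A, nbhs x A -> exists n, u n x /\ u n `<=` A.
  by move=> i; exact: second_countable_enum.
pose box (c : {ffun I -> nat}) : set (prod_topology T) :=
  [set g | forall i, u i (c i) (g i)].
have nbox (g : prod_topology T) c : box c g -> nbhs g (box c).
  move=> gc; suff : \forall h \near g, forall i, u i (c i) (h i) by [].
  apply: (@filter_forall _ _ (fun i h => u i (c i) (h i)) (nbhs g)) => i.
  apply: (@proj_continuous I T i g); apply: open_nbhs_nbhs; split; last exact: gc.
  exact: (uP i).1.
apply: (@enum_second_countable _ _ box) => [c|g A nA].
  by rewrite openE => g /nbox.
pose F := filter_from [set c | box c g] box.
have FF : Filter F.
  apply: filter_from_filter => [|c d cg dg].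
    have /choice_dep[c cP] : forall i, exists n, u i n (g i) /\ u i n `<=` setT.
      by move=> i; apply: (uP i).2; exact: filterT.
    by exists [ffun i => c i] => i; rewrite ffunE; exact: (cP i).1.
  have /choice_dep[e eP] : forall i, exists n, u i n (g i) /\
      u i n `<=` u i (c i) `&` u i (d i).
    move=> i; apply: (uP i).2; apply: open_nbhs_nbhs; split; last by split.
    by apply: openI; exact: (uP i).1.
  exists [ffun i => e i] => [i|x xe]; first by rewrite ffunE; exact: (eP i).1.
  by split=> i; have := xe i; rewrite ffunE => /(eP i).2[].
suff /(_ _ nA)[c gc cA] : F --> g by exists c.
apply: prod_topology_cvg => i B nB.
have [n [ung unB]] := (uP i).2 _ _ nB.
have /choice_dep[c cP] : forall j, exists n, u j n (g j) /\ u j n `<=` setT.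
  by move=> j; apply: (uP j).2; exact: filterT.
exists [ffun j => if j == i then n else c j] => [j|x /(_ i)].
  by rewrite ffunE; case: eqP => [->//|_]; exact: (cP j).1.
by rewrite ffunE eqxx => /unB.
Qed.

Section Gen.
Context {K : numFieldType}.

Lemma near_differentiable (V W : normedModType K) (f g : V -> W) (x : V) :
  (\forall y \near x, f y = g y) -> differentiable f x -> differentiable g x.
Proof.
move=> fg df.
have fgx : f x = g x by exact: nbhs_singleton fg.
have E : g \o shift x = cst (g x) + 'd f x +o_ (0 : V) id.
  apply/eqaddoP => _/posnumP[e].
  have /eqaddoP/(_ _ (gt0 e)) := diff_locally df.
  have : \forall y \near (0 : V), f (y + x) = g (y + x).
    by have := fg; rewrite (near_shift 0) /= subr0.
  apply: filterS2 => y fgy.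
  by rewrite !fctE /= fgy fgx.
apply/diff_locallyP.
have -> : 'd g x = 'd f x :> (V -> W).
  by apply: diff_unique => //; exact: diff_continuous.
by split => //; exact: diff_continuous.
Qed.

Lemma mx_differentiable (V : normedModType K) m n (f : V -> 'M[K]_(m, n)) (x : V) :
  (forall i j, differentiable (fun t => f t i j : K^o) x) -> differentiable f x.
Proof.
move=> fij.
have -> : f = \sum_(i < m) \sum_(j < n) (fun t => f t i j *: delta_mx i j).
  apply/funext => t; rewrite [LHS]matrix_sum_delta fct_sumE.
  by apply: eq_bigr => i _; rewrite fct_sumE.
apply: differentiable_sum => i; apply: differentiable_sum => j.
exact: differentiableZl.
Qed.

Lemma differentiable_row_mx (V : normedModType K) m n (f : V -> 'rV[K]_m)
    (g : V -> 'rV[K]_n) (x : V) : differentiable f x -> differentiable g x ->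
  differentiable (fun t => row_mx (f t) (g t)) x.
Proof.
move=> df dg; apply: mx_differentiable => i j.
rewrite -(splitK j); case: (fintype.split j) => k /=.
  under eq_fun do rewrite row_mxEl.
  exact: (@differentiable_comp _ _ _ _ f (fun N => N i k : K^o) x df (differentiable_coord _ _ _)).
under eq_fun do rewrite row_mxEr.
exact: (@differentiable_comp _ _ _ _ g (fun N => N i k : K^o) x dg (differentiable_coord _ _ _)).
Qed.

Lemma mx_continuous (T : topologicalType) m n (f : T -> 'M[K]_(m, n)) (x : T) :
  (forall i j, continuous_at x (fun t => f t i j)) -> continuous_at x f.
Proof.
move=> fij A [P nP PA]; rewrite !nbhs_simpl /=.
have : \forall t \near x, forall i j, P i j (f t i j).
  by apply: filter_forall => i; apply: filter_forall => j; apply: fij.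
by apply: filterS => t Pt; exact: PA.
Qed.

Lemma mx_coord_continuous (T : topologicalType) m n (f : T -> 'M[K]_(m, n)) (x : T) i j :
  continuous_at x f -> continuous_at x (fun t => f t i j).
Proof. move=> cf; exact: (@continuous_comp _ _ _ f (fun N => N i j) x cf (@coord_continuous _ _ _ i j _)). Qed.

Lemma row_mx_continuous (T : topologicalType) m n (f : T -> 'rV[K]_m)
    (g : T -> 'rV[K]_n) (x : T) : continuous_at x f -> continuous_at x g ->
  continuous_at x (fun t => row_mx (f t) (g t)).
Proof.
move=> df dg; apply: mx_continuous => i j.
rewrite -(splitK j); case: (fintype.split j) => k /=.
  by under eq_fun do rewrite row_mxEl; exact: mx_coord_continuous.
by under eq_fun do rewrite row_mxEr; exact: mx_coord_continuous.
Qed.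
End Gen.

Lemma near_continuous (T U : topologicalType) (f g : T -> U) (x : T) :
  (\forall y \near x, f y = g y) -> continuous_at x f -> continuous_at x g.
Proof.
move=> fg cf; have fgx : f x = g x by exact: nbhs_singleton fg.
move=> A nA; have := cf A; rewrite fgx => /(_ nA); rewrite !nbhs_simpl /= => fA.
by apply: filterS2 fg fA => y /= <-.
Qed.

Section Man.
Context {R : realType}.
Local Notation C := (CC R).

Lemma chart_invK n (M : charted R n) (p x : M) : is_chart_at p ->
  cdom (chart_at p) x -> chart_inv p (chart_map p x) = x.
Proof. by case=> _ inj _ _ Dx; by apply: pinvKV; [exact: inj|rewrite inE]. Qed.

Lemma coordK n (M : charted R n) (p : M) y :
  (chart_map p @` cdom (chart_at p)) y -> chart_map p (chart_inv p y) = y.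
Proof. by move=> Dy; apply: pinvK; rewrite ?inE. Qed.

Lemma chart_inv_continuous n (M : charted R n) (p x : M) : is_chart_at p ->
  cdom (chart_at p) x -> continuous_at (chart_map p x) (chart_inv p).
Proof. by case=> _ _ _ h Dx; apply: h; exists x. Qed.

Lemma chart_map_continuous n (M : charted R n) (p x : M) : is_chart_at p ->
  cdom (chart_at p) x -> continuous_at x (chart_map p).
Proof. by case=> _ _ h _ Dx; apply: h. Qed.

Lemma chart_center n (M : charted R n) (p : M) :
  is_chart_at p -> cdom (chart_at p) p.
Proof. by case=> [[]]. Qed.

Lemma chart_nbhs n (M : charted R n) (p x : M) : is_chart_at p ->
  cdom (chart_at p) x -> nbhs x (cdom (chart_at p)).
Proof. by case=> [[]] oD _ _ _ _ _ Dx; apply: open_nbhs_nbhs. Qed.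

Lemma chart_map_nbhs n (M : charted R n) (p x : M) : is_chart_at p ->
  cdom (chart_at p) x -> nbhs (chart_map p x) (chart_map p @` cdom (chart_at p)).
Proof. by case=> [[]] _ _ oI _ _ _ Dx; apply: open_nbhs_nbhs; split=> //; exists x. Qed.

Lemma holo_comp m n q (M : charted R m) (N : charted R n) (P : charted R q)
    (f : M -> N) (g : N -> P) (p : M) :
  is_chart_at p -> is_chart_at (f p) ->
  holo_at f p -> holo_at g (f p) -> holo_at (g \o f) p.
Proof.
move=> cp cfp [fc fd] [gc gd].
split; first exact: (continuous_comp fc gc).
have pE : chart_inv p (chart_map p p) = p.
  by rewrite chart_invK//; exact: chart_center.
have fpE : in_coords f p (chart_map p p) = chart_map (f p) (f p) by rewrite /in_coords /= pE.
apply: (@near_differentiable _ _ _ (in_coords g (f p) \o in_coords f p)); last first.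
  by apply: differentiable_comp fd _; rewrite fpE.
have cinv : continuous_at (chart_map p p) (f \o chart_inv p).
  apply: continuous_comp; last by rewrite pE.
  by apply: chart_inv_continuous => //; exact: chart_center.
have : \forall y \near chart_map p p, cdom (chart_at (f p)) (f (chart_inv p y)).
  by apply: cinv; rewrite /= pE; apply: chart_nbhs => //; exact: chart_center.
by apply: filterS => y Dy; rewrite /in_coords /= chart_invK.
Qed.

Lemma holo_at_near m n (M : charted R m) (N : charted R n) (f g : M -> N) (p : M) :
  is_chart_at p -> (\forall x \near p, f x = g x) -> holo_at f p -> holo_at g p.
Proof.
move=> cp fg [fc fd]; have fgp : f p = g p by exact: nbhs_singleton fg.
split; first exact: near_continuous fg fc.
apply: (near_differentiable _ fd); rewrite /in_coords /= fgp.
have cinv := chart_inv_continuous cp (chart_center cp).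
have : \forall y \near chart_map p p, f (chart_inv p y) = g (chart_inv p y).
  apply: (cinv [set x | f x = g x]); rewrite chart_invK//; exact: chart_center.
by apply: filterS => y /= ->.
Qed.

Lemma coord_affineE n (p : @affine_space R n) : chart_map p = id.
Proof. by []. Qed.

Lemma chart_inv_affineE n (p : @affine_space R n) : chart_inv p = id.
Proof. by apply/funext => y; rewrite -[LHS]/(chart_map p _) coordK//; exists y. Qed.

Lemma affine_chart n (p : @affine_space R n) : is_chart_at p.
Proof.
rewrite /is_chart_at chart_inv_affineE; split=> //; try by move=> ? _.
by split=> //; [exact: openT|rewrite /chart_map /= image_id; exact: openT].
Qed.

Lemma holo_affine m n (f : @affine_space R m -> @affine_space R n) p :
  differentiable f p -> holo_at f p.
Proof.
move=> df; split; first exact: differentiable_continuous.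
by rewrite /in_coords chart_inv_affineE.
Qed.

Lemma holo_pair m n q (M : charted R m) (N : charted R n) (P : charted R q)
    (f : M -> N) (g : M -> P) (p : M) :
  holo_at f p -> holo_at g p ->
  @holo_at _ _ _ M (prod_charted N P) (fun x => (f x, g x)) p.
Proof.
move=> [fc fd] [gc gd]; split; last exact: differentiable_row_mx fd gd.
exact: (cvg_pair fc gc).
Qed.

End Man.

Section Charts.
Context {R : realType}.
Local Notation C := (CC R).

Section intro.
Context {n : nat} (M : charted R n) (p : M).
Context (I : set 'rV[C]_n) (psi : 'rV[C]_n -> M).
Let D := cdom (chart_at p).
Hypothesis DI : forall x, D x -> I (chart_map p x) /\ psi (chart_map p x) = x.
Hypothesis ID : forall y, I y -> D (psi y) /\ chart_map p (psi y) = y.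

Lemma chart_inj_intro : {in D &, injective (chart_map p)}.
Proof.
move=> x y; rewrite !inE => /DI[_ xE] /DI[_ yE] xy.
by rewrite -xE xy.
Qed.

Lemma chart_image_intro : chart_map p @` D = I.
Proof.
rewrite eqEsubset; split=> [_ [x /DI[Ix _] <-]//|y /ID[Dy yE]].
by exists (psi y).
Qed.

Lemma chart_inv_intro y : I y -> chart_inv p y = psi y.
Proof.
move=> /ID[Dy yE]; rewrite -[in LHS]yE.
by apply: pinvKV; [exact: chart_inj_intro|rewrite inE].
Qed.

Lemma is_chart_intro : open D -> D p -> open I ->
  (forall x, D x -> continuous_at x (chart_map p)) ->
  (forall y, I y -> continuous_at y psi) -> is_chart_at p.
Proof.
move=> oD Dp oI cphi cpsi; split.
- by split=> //; rewrite -/D chart_image_intro.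
- exact: chart_inj_intro.
- by move=> x; exact: cphi.
- move=> y; rewrite -/D chart_image_intro => Iy.
  apply: (near_continuous _ (cpsi _ Iy)).
  have : \forall y' \near y, I y' by apply: open_nbhs_nbhs.
  by apply: filterS => y' /chart_inv_intro.
Qed.
End intro.

Lemma prod_chart m n (M : charted R m) (N : charted R n) (p : M) (q : N) :
  is_chart_at p -> is_chart_at q ->
  is_chart_at ((p, q) : prod_charted M N).
Proof.
move=> cp cq.
pose I1 := chart_map p @` cdom (chart_at p); pose I2 := chart_map q @` cdom (chart_at q).
have oI1 : open I1 by case: cp => [[]].
have oI2 : open I2 by case: cq => [[]].
apply: (@is_chart_intro _ (prod_charted M N) _
  ((lsubmx @^-1` I1) `&` (rsubmx @^-1` I2))
  (fun y => (chart_inv p (lsubmx y), chart_inv q (rsubmx y)))).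
- move=> [x x'] /= [Dx Dx']; rewrite /chart_map/= row_mxKl row_mxKr !chart_invK//.
  by split=> //; split; [exists x|exists x'].
- move=> y [[x Dx xE] [x' Dx' xE']] /=.
  rewrite -xE -xE' !chart_invK//; split=> //.
  by rewrite /chart_map /= -/(chart_map p) -/(chart_map q) xE xE' hsubmxK.
- rewrite openE => -[x x'] [/= Dx Dx'].
  exists (cdom (chart_at p), cdom (chart_at q)) => //=.
  by split; apply: chart_nbhs.
- by split; apply: chart_center.
- apply: openI; apply: open_comp => // y _.
    exact: continuous_lsubmx.
  exact: continuous_rsubmx.
- move=> [x x'] /= [Dx Dx'].
  apply: (@row_mx_continuous _ _ _ _ (fun y : M * N => chart_map p y.1)
     (fun y : M * N => chart_map q y.2)).
    apply: (@continuous_comp _ _ _ fst (chart_map p)); first exact: cvg_fst.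
    exact: chart_map_continuous.
  apply: (@continuous_comp _ _ _ snd (chart_map q)); first exact: cvg_snd.
  exact: chart_map_continuous.
- move=> y [[x Dx xE] [x' Dx' xE']] /=.
  have c1 : continuous_at y (chart_inv p \o lsubmx).
    apply: continuous_comp; first exact: continuous_lsubmx.
    by rewrite -xE; exact: chart_inv_continuous.
  have c2 : continuous_at y (chart_inv q \o rsubmx).
    apply: continuous_comp; first exact: continuous_rsubmx.
    by rewrite -xE'; exact: chart_inv_continuous.
  exact: (cvg_pair c1 c2).
Qed.

Lemma holo_snd m n q (M : charted R m) (N : charted R n) (P : charted R q)
    (f : M -> prod_charted N P) (p : M) :
  holo_at f p -> holo_at (fun x => (f x).2) p.
Proof.
move=> [fc fd]; split; first by apply: (continuous_comp fc); exact: cvg_snd.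
have -> : in_coords (fun x => (f x).2) p = rsubmx \o in_coords f p.
  by apply/funext => y; rewrite /in_coords /chart_map /= row_mxKr.
by apply: differentiable_comp fd _; exact: differentiable_rsubmx.
Qed.

End Charts.

Section Fiber.
Context {R : realType} {n m : nat} {Z : manifold R n} {X : manifold R m}.
Context {h : Z -> X} {k : nat} (E : 'I_k.+1 -> spray h) (z : Z).
Local Notation C := (CC R).
Local Notation F := (fiber_charted E z).
Local Notation r := (\sum_(j < k.+1) srank (E j))%N.

Lemma manifold_chart q (M : manifold R q) (p : M) : is_chart_at p.
Proof. by case: (manifoldP M). Qed.

Lemma val_continuous (j : 'I_k.+1) : continuous (fun e : F => val e j).
Proof.
move=> e.
apply: (@continuous_comp _ _ _ (fun e : F => val e : tuples E) (fun g : tuples E => g j)).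
  exact: initial_continuous.
exact: (@proj_continuous _ (fun j => tot (E j)) j).
Qed.

Section Chart.
Variable e0 : F.
Let w j := bproj (val e0 j).
Let U j := triv_dom (E j) (w j).
Let g j := projT1 (cid (triv_biholo (sbundle (E j)) (w j))).
Let gP j := projT2 (cid (triv_biholo (sbundle (E j)) (w j))).

Fixpoint fiber_base (y : 'rV[C]_r) (i : nat) : Z :=
  if i is i'.+1 then
    smap (E (inord i')) (@g (inord i') (fiber_base y i', submxrow y (inord i')))
  else z.

Definition fiber_tuple (y : 'rV[C]_r) : tuples E :=
  fun j => @g j (fiber_base y j, submxrow y j).

Definition fiber_codom : set 'rV[C]_r := [set y | forall j : 'I_k.+1, U j (fiber_base y j)].

Definition fiber_param (y : 'rV[C]_r) : F := insubd e0 (fiber_tuple y).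

Lemma fiber_tupleP y : fiber_codom y -> fiber_tuple y \in composed_fiber E z.
Proof.
move=> cy; rewrite inE.
have bE j : bproj (fiber_tuple y j) = fiber_base y j.
  have [_ _ _ /(_ (fiber_base y j, submxrow y j))[]] := @gP j; first by split=> //; exact: cy.
  by move=> _ [].
split=> [i j ij|]; last by rewrite /= /composed_proj bE.
by rewrite bE ij /= inord_val.
Qed.

Lemma fiber_paramE y : fiber_codom y -> val (fiber_param y) = fiber_tuple y.
Proof. by move=> /fiber_tupleP cy; rewrite insubdK. Qed.

Lemma fiber_base_chart (x : F) : cdom (chart_at e0) x ->
  forall j : 'I_k.+1, fiber_base (chart_map e0 x) j = bproj (val x j).
Proof.
move=> Dx; have [xc /= xz] : composed_fiber E z (val x) by exact/set_mem/valP.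
suff H : forall i (ik : (i < k.+1)%N),
    fiber_base (chart_map e0 x) i = bproj (val x (Ordinal ik)).
  by move=> [j jk]; exact: H.
elim=> [|i IH] ik.
  rewrite /= [LHS](esym xz) /composed_proj; congr (bproj (val x _)); exact: val_inj.
have ik' := ltnW ik.
have -> : fiber_base (chart_map e0 x) i.+1 = smap (E (Ordinal ik')) (val x (Ordinal ik')).
  rewrite /= (_ : inord i = Ordinal ik'); last first.
    by apply: val_inj; rewrite /= inordK.
  rewrite IH mxrowK; congr (smap _ _).
  have [_ _ /(_ (val x (Ordinal ik')) (Dx _))[_ gx] _] := @gP (Ordinal ik').
  exact: gx.
exact: xc.
Qed.

Lemma fiber_chartK (x : F) : cdom (chart_at e0) x ->
  fiber_codom (chart_map e0 x) /\ fiber_param (chart_map e0 x) = x.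
Proof.
move=> Dx; have cx : fiber_codom (chart_map e0 x).
  by move=> j; rewrite fiber_base_chart//; exact: Dx.
split=> //; apply: val_inj; rewrite fiber_paramE//.
apply: functional_extensionality_dep => j; rewrite /fiber_tuple fiber_base_chart// mxrowK.
have [_ _ /(_ (val x j) (Dx _))[_ gx] _] := @gP j.
exact: gx.
Qed.

Lemma fiber_paramK y : fiber_codom y ->
  cdom (chart_at e0) (fiber_param y) /\ chart_map e0 (fiber_param y) = y.
Proof.
move=> cy.
have tE j : (bproj (fiber_tuple y j), triv (E j) (w j) (fiber_tuple y j)) = (fiber_base y j, submxrow y j).
  by have [_ _ _ /(_ (fiber_base y j, submxrow y j))[]] := @gP j; first by split=> //; exact: cy.
split=> [j|]; first by rewrite /= fiber_paramE//; have [-> _] := tE j; exact: cy.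
apply/mxrowP => j; rewrite mxrowK fiber_paramE//.
by have [_ <-] := tE j.
Qed.

Lemma holo_submxrow j (y : 'rV[C]_r) :
  holo_at (M := affine_space r) (N := affine_space (srank (E j)))
    (fun y : 'rV[C]_r => submxrow y j) y.
Proof.
apply: holo_affine; apply: mx_differentiable => i l.
have -> : (fun t : 'rV[C]_r => submxrow t j i l) =
          (fun t => t i (tagnat.Rank j l)).
  by apply/funext => t; rewrite mxE.
exact: differentiable_coord.
Qed.

Lemma holo_fiber_step (j : 'I_k.+1) y : fiber_codom y ->
  holo_at (M := affine_space r) (N := Z) (fun y => fiber_base y j) y ->
  holo_at (M := affine_space r) (N := tot (E j)) (fun y => fiber_tuple y j) y.
Proof.
move=> cy hb.
have [_ hg _ _] := @gP j.
have hp := @holo_pair _ _ _ _ (affine_space r) Z (affine_space (srank (E j))) _ _ y hb (holo_submxrow j y).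
have hgj : holo_at (@g j) (fiber_base y j, submxrow y j) by apply: hg; split=> //; exact: cy.
have cp := prod_chart (manifold_chart (fiber_base y j)) (affine_chart (submxrow y j)).
exact: (holo_comp (affine_chart y) cp hp hgj).
Qed.

Lemma holo_fiber_base y : fiber_codom y -> forall i, (i < k.+1)%N ->
  holo_at (M := affine_space r) (N := Z) (fun y => fiber_base y i) y.
Proof.
move=> cy; elim=> [|i IH] ik.
  split; first exact: cst_continuous.
  exact: (@differentiable_cst _ _ _ (chart_map z z)).
have ik' := ltnW ik.
have -> : (fun y => fiber_base y i.+1) =
    smap (E (inord i)) \o (fun y => fiber_tuple y (inord i)).
  by apply/funext => y'; rewrite /= /fiber_tuple inordK.
have ht : holo_at (M := affine_space r) (N := tot (E (inord i)))
    (fun y => fiber_tuple y (inord i)) y.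
  by apply: holo_fiber_step => //; rewrite inordK//; exact: IH.
have hs : holo_at (smap (E (inord i))) (fiber_tuple y (inord i)) by exact: smap_holo.
exact: (holo_comp (affine_chart y) (manifold_chart _) ht hs).
Qed.

Lemma holo_fiber_tuple y j : fiber_codom y ->
  holo_at (M := affine_space r) (N := tot (E j)) (fun y => fiber_tuple y j) y.
Proof. by move=> cy; apply: holo_fiber_step => //; exact: holo_fiber_base. Qed.

Lemma fiber_codom_open : open fiber_codom.
Proof.
rewrite openE => y cy.
suff : \forall y' \near y, forall j : 'I_k.+1, U j (fiber_base y' j) by [].
apply: (@filter_forall _ _ (fun (j : 'I_k.+1) y' => U j (fiber_base y' j)) (nbhs y)) => j.
have [bc _] := holo_fiber_base cy (ltn_ord j).
by apply: bc; apply: open_nbhs_nbhs; split; [exact: triv_open|exact: cy].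
Qed.

Lemma fiber_param_continuous y : fiber_codom y -> continuous_at y fiber_param.
Proof.
move=> cy.
have nc : \forall y' \near y, fiber_codom y'.
  by apply: open_nbhs_nbhs; split; [exact: fiber_codom_open|].
have H : (fun y' => val (fiber_param y') : tuples E) @ y --> (val (fiber_param y) : tuples E).
  apply: (@prod_topology_cvg _ (fun j => tot (E j)) _ _ (fmap_filter _ (nbhs_filter y))) => j.
  have [tc _] := holo_fiber_tuple j cy.
  apply: (@near_continuous _ _ (fun y => fiber_tuple y j) (fun y' => val (fiber_param y') j) y _ tc).
  by apply: filterS nc => y' /fiber_paramE ->.
exact: (@initial_cvg _ _ (@set_val _ (composed_fiber E z)) (fiber_param @ y) (fiber_param y)
  (fmap_filter _ (nbhs_filter y)) H).
Qed.

Lemma triv_holo j (e : tot (E j)) : U j (bproj e) ->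
  holo_at (N := affine_space (srank (E j))) (triv (E j) (w j)) e.
Proof.
move=> Ue; have [/(_ _ Ue) H _ _ _] := @gP j.
exact: holo_snd H.
Qed.

Lemma fiber_dom_open : open (cdom (chart_at e0)).
Proof.
rewrite openE => x Dx.
suff : \forall x' \near x, forall j : 'I_k.+1, U j (bproj (val x' j)) by [].
apply: (@filter_forall _ _ (fun (j : 'I_k.+1) (x' : F) => U j (bproj (val x' j))) (nbhs x)) => j.
have [bc _] : holo_at (@bproj _ _ _ _ (E j)) (val x j) by exact: bproj_holo.
have c := continuous_comp (@val_continuous j x) bc.
by apply: c; apply: open_nbhs_nbhs; split; [exact: triv_open|exact: Dx].
Qed.

Lemma fiber_chart_continuous (x : F) : cdom (chart_at e0) x ->
  continuous_at x (chart_map e0).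
Proof.
move=> Dx; apply: mx_continuous => i l.
have -> : (fun t => chart_map e0 t i l) =
    (fun t : F => triv (E (tagnat.sig1 l)) (w (tagnat.sig1 l)) (val t (tagnat.sig1 l)) i (tagnat.sig2 l)).
  by apply/funext => t; rewrite mxE.
apply: mx_coord_continuous.
have [tc _] := triv_holo (Dx (tagnat.sig1 l)).
exact: (continuous_comp (@val_continuous _ x) tc).
Qed.

Lemma fiber_chart : is_chart_at e0.
Proof.
apply: (is_chart_intro fiber_chartK fiber_paramK).
- exact: fiber_dom_open.
- by move=> j /=; exact: triv_mem.
- exact: fiber_codom_open.
- exact: fiber_chart_continuous.
- exact: fiber_param_continuous.
Qed.

End Chart.

Lemma fiber_compatible (p q : F) : compatible_charts p q.
Proof.
move=> x Dp Dq.
have [cx px] := fiber_chartK Dp.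
apply: (@near_differentiable _ _ _
  (fun y => \mxrow_j triv (E j) (bproj (val q j)) (fiber_tuple p y j))).
  have : \forall y' \near chart_map p x, fiber_codom p y'.
    by apply: open_nbhs_nbhs; split; [exact: fiber_codom_open|].
  apply: filterS => y cy /=.
  by rewrite (chart_inv_intro (@fiber_chartK p) (@fiber_paramK p))// /chart_map /= fiber_paramE.
apply: mx_differentiable => i l.
pose j := tagnat.sig1 l.
pose f y := triv (E j) (bproj (val q j)) (fiber_tuple p y j).
have -> : (fun t => (\mxrow_j triv (E j) (bproj (val q j)) (fiber_tuple p t j)) i l) =
    (fun t => f t i (tagnat.sig2 l)).
  by apply/funext => t; rewrite mxE.
have tE : fiber_tuple p (chart_map p x) j = val x j by rewrite -fiber_paramE// px.
have hq : holo_at (N := affine_space (srank (E j)))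
    (triv (E j) (bproj (val q j))) (fiber_tuple p (chart_map p x) j).
  by apply: triv_holo; rewrite tE; exact: Dq.
have [_ df] := holo_comp (affine_chart (chart_map p x)) (manifold_chart _)
  (holo_fiber_tuple j cx) hq.
have {}df : differentiable f (chart_map p x).
  by move: df; rewrite /in_coords chart_inv_affineE.
exact: (@differentiable_comp _ _ _ _ f (fun N => N i (tagnat.sig2 l) : C^o) _ df (differentiable_coord _ _ _)).
Qed.

Lemma fiber_hausdorff : hausdorff_space F.
Proof.
move=> x y xy; apply: val_inj; apply: (@hausdorff_product _ (fun j => tot (E j))).
  by move=> j; case: (manifoldP (tot (E j))).
move=> A B nA nB.
have vc : continuous (fun e : F => val e : tuples E) by exact: initial_continuous.
by have [t [At Bt]] := xy _ _ (vc x A nA) (vc y B nB); exists (val t).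
Qed.

Lemma fiber_manifoldP : is_manifold F.
Proof.
split.
- exact: fiber_hausdorff.
- apply: set_type_second_countable; apply: prod_second_countable => j.
  by case: (manifoldP (tot (E j))).
- exact: fiber_chart.
- exact: fiber_compatible.
Qed.
End Fiber.

Section ComposedDominating.
Context {R : realType} {n m : nat} {Z : manifold R n} {X : manifold R m}.
Context {h : Z -> X} {k : nat} (E : 'I_k.+1 -> spray h) (z : Z).

Definition fiber_manifold : manifold R (\sum_(j < k.+1) srank (E j)) :=
  Manifold (fiber_manifoldP E z).

Definition fiber_zero : fiber_manifold := SigSub (composed_zeroP E z).

Definition fiber_map : fiber_manifold -> Z := fun e => composed_map E (val e).

Definition composed_dominating : Prop :=
  range (tangent fiber_map fiber_zero) = VT h z.

End ComposedDominating.

(* Main.v *)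
(** Trivialize each [E_j] near [z] and write [sigma_j (w, v)] for [s_j] in that
trivialization.  Since [sigma_j (w, 0) = w], the derivative of [sigma_j] at
[(z, 0)] is [(u, v) |-> u + B_j v], where [B_j] has image [(ds_j)(E_(j,z))].
In the fiber coordinates [(v_0, ..., v_k)] of [E^*_z] the base points satisfy
[w_0 = z] and [w_(j+1) = sigma_j (w_j, v_j)], so by the chain rule the
derivative of [s^*] on the fiber is [sum_j B_j v_j].  Its image is exactly the
sum of the images of the [B_j]. *)
Require Import Defs.
From mathcomp Require Import all_boot all_order all_algebra.
From mathcomp Require Import all_classical all_reals all_analysis.

Set Implicit Arguments.
Unset Strict Implicit.
Unset Printing Implicit Defensive.

Import GRing.Theory Num.Theory.
Import numFieldNormedType.Exports.

Local Open Scope classical_set_scope.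
Local Open Scope ring_scope.

(** * Differentials in normed spaces: germs and block rows *)

(** A first-order expansion of [f] at [x] is also one of [g], since only small increments matter;
    uniqueness of the differential concludes. *)
Lemma near_diff (K : numFieldType) (V W : normedModType K) (f g : V -> W) (x : V) :
  (\forall y \near x, f y = g y) -> differentiable f x ->
  'd g x = 'd f x :> (V -> W).
Proof.
move=> fg df; have fgx : f x = g x by exact: nbhs_singleton fg.
apply: diff_unique; first exact: diff_continuous.
apply/eqaddoP => _/posnumP[e].
have /eqaddoP/(_ _ (gt0 e)) := diff_locally df.
have : \forall y \near (0 : V), f (y + x) = g (y + x).
  by have := fg; rewrite (near_shift 0) /= subr0.
by apply: filterS2 => y fgy; rewrite !fctE /= fgy fgx.
Qed.

(** Each block is recovered by composing with the continuous linear map [lsubmx] or [rsubmx], so the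
    chain rule identifies the blocks of the differential. *)
Lemma diff_row_mx (K : numFieldType) (V : normedModType K) m n
    (f : V -> 'rV[K]_m) (g : V -> 'rV[K]_n) (x : V) :
  differentiable f x -> differentiable g x ->
  'd (fun t => row_mx (f t) (g t)) x =
    (fun v => row_mx ('d f x v) ('d g x v)) :> (V -> _).
Proof.
move=> df dg; set F := fun t => row_mx (f t) (g t).
have dF : differentiable F x by exact: differentiable_row_mx.
have lF : lsubmx \o F = f by apply/funext => t; rewrite /= row_mxKl.
have rF : rsubmx \o F = g by apply/funext => t; rewrite /= row_mxKr.
apply/funext => v; rewrite -[LHS]hsubmxK; congr row_mx.
  rewrite -[in RHS]lF diff_comp//; last exact: differentiable_lsubmx.
  by rewrite diff_lin//; exact: continuous_lsubmx.
rewrite -[in RHS]rF diff_comp//; last exact: differentiable_rsubmx.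
by rewrite diff_lin//; exact: continuous_rsubmx.
Qed.

Lemma sum_ord_ltS (V : nmodType) n (F : 'I_n -> V) (i : 'I_n) :
  \sum_(j < n | (j < i.+1)%N) F j = \sum_(j < n | (j < i)%N) F j + F i.
Proof.
rewrite (bigD1 i)//= addrC; congr (_ + _); apply: eq_bigl => j.
by rewrite ltnS [RHS]ltn_neqAle andbC.
Qed.

(** * Calculus of [tangent] in preferred charts *)

Section Tangent.
Context {R : realType}.
Local Notation C := (CC R).

Lemma in_coords_center m n (M : charted R m) (N : charted R n) (f : M -> N) p :
  is_chart_at p -> in_coords f p (chart_map p p) = chart_map (f p) (f p).
Proof. by move=> cp; rewrite /in_coords /= chart_invK//; exact: chart_center. Qed.

(** The coordinate form of [g \o f] is the composite of the coordinate forms only where [f] lands in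
    the chart at [f p]. By continuity this holds near [p], which suffices for the differential. *)
Lemma tangent_comp m n q (M : charted R m) (N : charted R n) (P : charted R q)
    (f : M -> N) (g : N -> P) (p : M) :
  is_chart_at p -> is_chart_at (f p) -> holo_at f p -> holo_at g (f p) ->
  tangent (g \o f) p = tangent g (f p) \o tangent f p.
Proof.
move=> cp cfp [fc fd] [gc gd].
have pE : chart_inv p (chart_map p p) = p.
  by rewrite chart_invK//; exact: chart_center.
have fpE := in_coords_center f cp.
have dg : differentiable (in_coords g (f p)) (in_coords f p (chart_map p p)).
  by rewrite fpE.
rewrite /tangent (@near_diff _ _ _ (in_coords g (f p) \o in_coords f p)).
- by rewrite (diff_comp fd dg) fpE.
- have cinv : continuous_at (chart_map p p) (f \o chart_inv p).
    apply: continuous_comp; last by rewrite pE.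
    by apply: chart_inv_continuous => //; exact: chart_center.
  have : \forall y \near chart_map p p, cdom (chart_at (f p)) (f (chart_inv p y)).
    by apply: cinv; rewrite /= pE; apply: chart_nbhs => //; exact: chart_center.
  by apply: filterS => y Dy; rewrite /in_coords /= chart_invK.
- exact: differentiable_comp.
Qed.

Lemma holo_id m (M : charted R m) (p : M) : is_chart_at p -> holo_at (id : M -> M) p.
Proof.
move=> cp; split; first exact: cvg_id.
apply: (@near_differentiable _ _ _ id).
  by apply: filterS (chart_map_nbhs cp (chart_center cp)) => y /coordK /esym.
by apply: (@linear_differentiable _ _ _ idfun) => x; exact: cvg_id.
Qed.

Lemma holo_cst m n (M : charted R m) (N : charted R n) (q : N) (p : M) :
  holo_at (cst q : M -> N) p.
Proof.
split; first exact: cst_continuous.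
exact: (@differentiable_cst _ _ _ (chart_map q q)).
Qed.

Lemma tangent_id m (M : charted R m) (p : M) : is_chart_at p ->
  tangent (id : M -> M) p = id.
Proof.
move=> cp; rewrite /tangent (@near_diff _ _ _ id).
- by rewrite (@diff_lin _ _ _ idfun)// => x; exact: cvg_id.
- by apply: filterS (chart_map_nbhs cp (chart_center cp)) => y /coordK /esym.
- by apply: (@linear_differentiable _ _ _ idfun) => x; exact: cvg_id.
Qed.

Lemma tangent_cst m n (M : charted R m) (N : charted R n) (q : N) (p : M) :
  tangent (cst q : M -> N) p = 0.
Proof. exact: (@diff_cst _ _ _ (chart_map q q)). Qed.

Lemma tangent_near m n (M : charted R m) (N : charted R n) (f g : M -> N) (p : M) :
  is_chart_at p -> (\forall x \near p, f x = g x) -> holo_at f p ->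
  tangent g p = tangent f p.
Proof.
move=> cp fg [_ fd]; have fgp : f p = g p by exact: nbhs_singleton fg.
apply: near_diff fd; rewrite /in_coords /= fgp.
have cinv := chart_inv_continuous cp (chart_center cp).
have : \forall y \near chart_map p p, f (chart_inv p y) = g (chart_inv p y).
  apply: (cinv [set x | f x = g x]); rewrite chart_invK//; exact: chart_center.
by apply: filterS => y /= ->.
Qed.

Lemma tangent_pair m n q (M : charted R m) (N : charted R n) (P : charted R q)
    (f : M -> N) (g : M -> P) (p : M) : holo_at f p -> holo_at g p ->
  tangent ((fun x => (f x, g x)) : M -> prod_charted N P) p =
    fun v => row_mx (tangent f p v) (tangent g p v).
Proof. by move=> [_ fd] [_ gd]; exact: (diff_row_mx fd gd). Qed.

Lemma tangent_affine m n (f : {linear 'rV[C]_m -> 'rV[C]_n}) p : continuous f ->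
  tangent (f : affine_space m -> affine_space n) p = f.
Proof.
move=> cf; rewrite /tangent /in_coords chart_inv_affineE.
exact: (@diff_lin _ _ _ f).
Qed.

End Tangent.

(** * A single spray in a local trivialization *)

Section Spray.
Context {R : realType} {n m : nat} {Z : manifold R n} {X : manifold R m}.
Context {h : Z -> X} (S : spray h) (c z : Z).
Local Notation C := (CC R).
Local Notation r := (srank S).
Context (g : prod_charted Z (affine_space r) -> tot S).
Hypothesis cz : triv_dom S c z.
Hypothesis gP : biholo (M := tot S) (N := prod_charted Z (affine_space r))
  (@bproj _ _ _ _ S @^-1` triv_dom S c) (triv_dom S c `*` setT)
  (fun e => (bproj e, triv S c e)) g.
Local Notation z0 := ((z, 0) : prod_charted Z (affine_space r)).

Lemma triv_inv (e : tot S) : triv_dom S c (bproj e) -> g (bproj e, triv S c e) = e.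
Proof. by move=> ce; have [_ _ /(_ _ ce)[]] := gP. Qed.

Lemma triv_inv_zero w : triv_dom S c w -> g (w, 0) = vzero S w.
Proof.
move=> cw; have [tz _ _] := triv_linear S c.
by rewrite -[RHS]triv_inv bproj_zero// tz.
Qed.

Lemma spray_triv_holo : holo_at (smap S \o g) z0.
Proof.
have [_ gh _ _] := gP.
have cz0 := prod_chart (manifold_chart z) (affine_chart (0 : affine_space r)).
apply: (holo_comp cz0 (manifold_chart _)); first by apply: gh; split.
exact: smap_holo.
Qed.

(** Along the zero section [zs], the map [smap S \o g] is the identity near [z]; differentiating
    this shows that its derivative sends [(u, 0)] to [u]. Linearity gives the rest. *)
Lemma tangent_spray_triv u v :
  tangent (smap S \o g) z0 (row_mx u v) =
  u + tangent (smap S \o g) z0 (row_mx 0 v).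
Proof.
have -> : row_mx u v = row_mx u 0 + row_mx 0 v :> 'rV[C]_(n + r).
  by rewrite add_row_mx addr0 add0r.
rewrite /tangent linearD; congr (_ + _); rewrite -/(tangent _ _).
pose zs : Z -> prod_charted Z (affine_space r) := fun w => (w, 0).
have cp := manifold_chart z.
have hid := holo_id cp.
have hcst := @holo_cst _ _ _ Z (affine_space r) 0 z.
have hz : holo_at zs z := holo_pair hid hcst.
have cz0 := prod_chart cp (affine_chart (0 : affine_space r)).
have tE : tangent ((smap S \o g) \o zs) z = id.
  rewrite (tangent_near cp _ hid) ?tangent_id//.
  have : \forall w \near z, triv_dom S c w.
    by apply: open_nbhs_nbhs; split=> //; exact: triv_open.
  by apply: filterS => w cw; rewrite /= triv_inv_zero// smap_zero.
rewrite -[RHS]/(id u) -tE (tangent_comp cp cz0 hz spray_triv_holo) /=.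
by rewrite (tangent_pair hid hcst) tangent_id// tangent_cst.
Qed.

(** The trivialization turns the curve [t |-> t e] into [t |-> (z, t v)]. Its coordinate expression
    [l] is an affine line with velocity [(0, v)], to which the chain rule applies. *)
Lemma vertical_triv (e : tot S) : bproj e = z ->
  vertical z e = tangent g z0 (row_mx 0 (triv S c e)).
Proof.
move=> ez; set v := triv S c e.
have cz0 := prod_chart (manifold_chart z) (affine_chart (0 : affine_space r)).
have [_ gh _ _] := gP.
have [_ gd] : holo_at g z0 by apply: gh; split.
pose l (t : C^o) : 'rV[C]_(n + r) := row_mx (chart_map z z) (t *: v).
have l0 : l 0 = chart_map z0 z0 by rewrite /l scale0r.
have dv : differentiable (fun t : C^o => t *: v) 0.
  exact: (@differentiableZl _ _ _ (id : C^o -> C) v 0).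
have dc : differentiable (cst (chart_map z z) : C^o -> 'rV[C]_n) 0.
  exact: differentiable_cst.
have dl : differentiable l 0 by exact: differentiable_row_mx.
have lE : (fun t : C^o => chart_map (vzero S z) (vscale t e)) = in_coords g z0 \o l.
  apply/funext => t; rewrite -[RHS]/(in_coords g z0 (chart_map z0 (z, t *: v))).
  rewrite /in_coords /= chart_invK//; last by split=> //; exact/chart_center/manifold_chart.
  have [_ _ tZ] := triv_linear S c.
  rewrite triv_inv_zero//; congr chart_map.
  by rewrite -[LHS]triv_inv bproj_scale ez// tZ// ez.
have gdl : differentiable (in_coords g z0) (l 0) by rewrite l0.
have dl1 : 'd l 0 1 = row_mx 0 v.
  rewrite (diff_row_mx dc dv) diff_cst; congr row_mx.
  rewrite (@diffZl _ _ _ (id : C^o -> C) v 0)//.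
  by rewrite (@diff_lin _ _ _ idfun) ?scale1r// => x; exact: cvg_id.
rewrite /vertical lE deriveE; last exact: differentiable_comp.
by rewrite (diff_comp dl gdl) /= dl1 l0.
Qed.

(** The fiber over [z] is parametrized by [v |-> g (z, v)], so vertical vectors are exactly the
    images under the derivative of [g] of the vectors [(0, v)]. *)
Lemma spray_image_triv :
  spray_image S z = range (fun v => tangent (smap S \o g) z0 (row_mx 0 v)).
Proof.
have cz0 := prod_chart (manifold_chart z) (affine_chart (0 : affine_space r)).
have [_ gh _ gK] := gP.
have hg : holo_at g z0 by apply: gh; split.
have hs : holo_at (smap S) (g z0) by exact: smap_holo.
have tE v : tangent (smap S \o g) z0 v = tangent (smap S) (vzero S z) (tangent g z0 v).
  by rewrite (tangent_comp cz0 (manifold_chart _) hg hs) /= (triv_inv_zero cz).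
rewrite eqEsubset; split=> [_ [e ez <-]|_ [v _ <-]].
  exists (triv S c e) => //.
  by rewrite (vertical_triv ez) tE.
have [_ [bE tvE]] := gK (z, v) (conj cz I).
exists (g (z, v)) => //.
by rewrite (vertical_triv bE) tvE tE.
Qed.

End Spray.

(** * First-order expansion of the composed spray on its fiber *)

Section Composed.
Context {R : realType} {n m : nat} {Z : manifold R n} {X : manifold R m}.
Context {h : Z -> X} {k : nat} (E : 'I_k.+1 -> spray h) (z : Z).
Local Notation C := (CC R).
Local Notation r := (\sum_(j < k.+1) srank (E j))%N.
Local Notation e0 := (fiber_zero E z).

(** These are the same terms as in the fiber chart at [e0], so [fiber_base] unfolds to this [g] by
    conversion. The center [w j] equals [z] only through [bproj_zero]. *)
Let w (j : 'I_k.+1) : Z := bproj (val e0 j).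
Let g (j : 'I_k.+1) := projT1 (cid (triv_biholo (sbundle (E j)) (w j))).
Let gP (j : 'I_k.+1) := projT2 (cid (triv_biholo (sbundle (E j)) (w j))).

(** The map [B_j] of the outline above. *)
Definition spray_fiber_diff (j : 'I_k.+1) (v : 'rV[C]_(srank (E j))) : 'rV[C]_n :=
  tangent (smap (E j) \o @g j) ((z, 0) : prod_charted Z (affine_space _)) (row_mx 0 v).

Lemma fiber_zero_center j : triv_dom (E j) (w j) z.
Proof. by have -> : w j = z by [exact: bproj_zero]; exact: triv_mem. Qed.

Lemma spray_image_fiber_diff j : spray_image (E j) z = range (@spray_fiber_diff j).
Proof. by rewrite (spray_image_triv (fiber_zero_center j) (@gP j)). Qed.

Lemma fiber_zero_coords : chart_map e0 e0 = 0 :> 'rV[C]_r.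
Proof.
apply/mxrowP => j; rewrite /chart_map /= mxrowK [RHS](@submxrow0 C).
have [t0 _ _] := triv_linear (E j) (w j).
by apply: t0; exact: fiber_zero_center.
Qed.

Lemma fiber_zero_codom : fiber_codom e0 (0 : 'rV[C]_r).
Proof.
rewrite -fiber_zero_coords.
have := @fiber_chartK _ _ _ _ _ _ _ E z e0 e0; case=> //.
by move=> j; exact: triv_mem.
Qed.

Lemma fiber_base_zero i : (i <= k.+1)%N -> fiber_base e0 (0 : 'rV[C]_r) i = z.
Proof.
case: i => [//|i] ik; pose j : 'I_k.+1 := inord i.
(* The chart computes base points only for indices up to [k]; one unfolding of the recursion then
   reaches [k.+1], where the value is that of the composed spray. *)
have IH : fiber_base e0 (0 : 'rV[C]_r) i = z.
  have := @fiber_base_chart _ _ _ _ _ _ _ E z e0 e0 _ (Ordinal ik).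
  rewrite fiber_zero_coords => -> /=; first by rewrite bproj_zero.
  by move=> l; exact: triv_mem.
rewrite -[LHS]/(smap (E j) (@g j (fiber_base e0 0 i, submxrow 0 j))) IH submxrow0.
rewrite -[RHS](smap_zero (E j)); congr smap.
exact: (triv_inv_zero (@gP j) (fiber_zero_center j)).
Qed.

Lemma tangent_submxrow (j : 'I_k.+1) y :
  tangent (M := affine_space r) (N := affine_space (srank (E j)))
    (fun y : 'rV[C]_r => submxrow y j) y = fun y => submxrow y j.
Proof.
(* Extracting a block is right multiplication by the matching block of columns of the identity,
   which exhibits it as linear. *)
pose f : {linear 'rV[C]_r -> 'rV[C]_(srank (E j))} := mulmxr (submxrow 1%:M j).
have fE : (fun y : 'rV[C]_r => submxrow y j) = f.
  by apply/funext => t; rewrite /= mul_submxrow mulmx1.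
have cf : continuous (f : 'rV[C]_r -> 'rV[C]_(srank (E j))).
  by move=> x; have [] := @holo_submxrow _ _ _ _ _ _ _ E j x; rewrite fE.
by rewrite fE; exact: tangent_affine.
Qed.

(** Induction along the chain of base points: by [tangent_spray_triv], each spray keeps the
    derivative accumulated so far and adds its own [B_j]. Holomorphy is carried along because the
    chain rule requires it. *)
Lemma fiber_base_first_order i : (i <= k.+1)%N ->
  holo_at (M := affine_space r) (N := Z) (fun y => fiber_base e0 y i) 0 /\
  tangent (M := affine_space r) (N := Z) (fun y => fiber_base e0 y i) 0 =
  fun y => \sum_(j < k.+1 | (j < i)%N) spray_fiber_diff (submxrow y j).
Proof.
elim: i => [_|i IH ik].
  split; first exact: (@holo_cst _ _ _ (affine_space r) Z z 0).
  apply/funext => y; rewrite (@tangent_cst _ _ _ (affine_space r) Z z 0).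
  by rewrite [RHS]big_pred0.
have [hb tb] := IH (ltnW ik).
have b0 := fiber_base_zero (ltnW ik).
pose j : 'I_k.+1 := inord i; have ji : j = i :> nat by rewrite /j inordK.
have hr := @holo_submxrow _ _ _ _ _ _ _ E j 0.
pose p (y : affine_space r) : prod_charted Z (affine_space (srank (E j))) :=
  (fiber_base e0 y i, submxrow y j).
have hp : holo_at p 0 := holo_pair hb hr.
have p0 : p 0 = (z, 0) by rewrite /p b0 (@submxrow0 C).
have hs := spray_triv_holo (fiber_zero_center j) (@gP j).
have -> : (fun y => fiber_base e0 y i.+1) = (smap (E j) \o @g j) \o p by [].
have cz0 := prod_chart (manifold_chart z) (affine_chart (0 : affine_space (srank (E j)))).
rewrite -p0 in cz0 hs.
split; first exact: (holo_comp (affine_chart _) cz0 hp hs).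
rewrite (tangent_comp (affine_chart _) cz0 hp hs) p0.
apply/funext => y; rewrite /= (tangent_pair hb hr) tb tangent_submxrow.
rewrite (tangent_spray_triv (fiber_zero_center j) (@gP j)).
by rewrite -[in RHS]ji [RHS](@sum_ord_ltS 'rV[C]_n) ji.
Qed.

(** In the fiber coordinates near 0 the composed map is the last base point [fiber_base e0 y k.+1],
    whose derivative is the full sum. *)
Lemma tangent_fiber_map :
  tangent (@fiber_map _ _ _ _ _ _ _ E z) e0 =
  fun y => \sum_(j < k.+1) spray_fiber_diff (submxrow y j).
Proof.
have [[_ hb] tb] := fiber_base_first_order (leqnn k.+1).
transitivity (tangent (M := affine_space r) (N := Z) (fun y => fiber_base e0 y k.+1) 0); last first.
  by rewrite tb; apply/funext => y; apply: eq_bigl => j; rewrite ltn_ord.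
rewrite /tangent fiber_zero_coords; apply: near_diff hb.
have : \forall y \near (0 : 'rV[C]_r), fiber_codom e0 y.
  by apply: open_nbhs_nbhs; split; [exact: fiber_codom_open|exact: fiber_zero_codom].
apply: filterS => y cy; rewrite /in_coords chart_inv_affineE.
(* The target charts are taken at the images of the two centers; both images are [z]. *)
rewrite -[LHS]/(chart_map (fiber_base e0 0 k.+1) (fiber_base e0 y k.+1)) fiber_base_zero//.
rewrite -[RHS]/(chart_map (smap (E ord_max) (vzero (E ord_max) z)) (fiber_map (chart_inv e0 y))).
rewrite smap_zero; congr chart_map.
rewrite (chart_inv_intro (@fiber_chartK _ _ _ _ _ _ _ E z e0) (@fiber_paramK _ _ _ _ _ _ _ E z e0) cy).
rewrite /fiber_map /composed_map (fiber_paramE cy).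
have -> : ord_max = inord k :> 'I_k.+1 by apply: val_inj; rewrite /= inordK.
by rewrite /fiber_tuple inordK.
Qed.

End Composed.

Theorem lemma2p4 (R : realType) (n m : nat) (Z : manifold R n) (X : manifold R m)
    (h : Z -> X) (h_submersion : submersion h) (z : Z)
    (k : nat) (E : 'I_k.+1 -> spray h) :
  dominating E z <-> composed_dominating E z.
Proof.
rewrite /dominating /composed_dominating tangent_fiber_map.
set A := (X in X = _ <-> _); set B := (X in _ <-> X = _).
(* Both conditions compare a set with [VT h z], so equality of the two sets is enough. *)
suff -> : A = B by [].
rewrite eqEsubset; split=> [_ [v vE <-]|_ [y _ <-]].
  have uex j : exists u, spray_fiber_diff (E := E) z (j := j) u = v j.
    by have := vE j; rewrite spray_image_fiber_diff => -[u _ <-]; exists u.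
  have [u uE] := choice_dep uex.
  (* The fiber coordinates of different sprays are independent, so preimages chosen separately
     assemble into one vector. *)
  exists (\mxrow_j u j) => //.
  by apply: eq_bigr => j _; rewrite mxrowK uE.
exists (fun j => spray_fiber_diff (E := E) z (submxrow y j)) => // j.
by rewrite /= spray_image_fiber_diff; exists (submxrow y j).
Qed.
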